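(* Let $\Omega$ be a nonempty compact metric space, let $U=V=C(\Omega)$ be the space of real-valued continuous functions on $\Omega$ with the pointwise order, let $\tau$ be the topology induced by the supremum norm, and let $\mathcal{K}_0\subset C(\Omega)$ be a convex cone. Let $\mathcal{C}:=\mathcal{K}_0-C(\Omega)_+$. Then the following statements are equivalent: (i) $\mathcal{K}_0$ satisfies NFL$_\tau$, that is, $\overline{\mathcal{C}}^{\tau}\cap C(\Omega)_+=\{0\}$. (ii) There exists a separating measure $\mathbb{Q}$ for $\mathcal{C}$ with $\operatorname{supp}(\mathbb{Q})=\Omega$.
   Context: $C(\Omega)_+$ denotes the nonnegative functions in $C(\Omega)$, and $\overline{\mathcal{C}}^{\tau}$ the closure in supremum norm. A convex cone is a nonempty set closed under $ax+by$ for $a,b\geq0$ (in particular it contains $0$). A separating measure for $\mathcal{C}$ is a probability measure $\mathbb{Q}$ on $\Omega$ equipped with its Borel $\sigma$-algebra such that $\mathbb{E}_{\mathbb{Q}}[X]\leq0$ for all $X\in\mathcal{C}$. The support $\operatorname{supp}(\mathbb{Q})$ is the set of points all of whose open neighborhoods have strictly positive $\mathbb{Q}$-measure. *)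

(* Defs.v *)
From HB Require Import structures.
From mathcomp Require Import all_boot all_order all_algebra.
From mathcomp Require Import all_classical all_reals all_analysis.

Set Implicit Arguments.
Unset Strict Implicit.
Unset Printing Implicit Defensive.

Import Order.TTheory GRing.Theory Num.Theory.
Import numFieldNormedType.Exports.

Local Open Scope classical_set_scope.
Local Open Scope ring_scope.

(* Nonempty metric spaces. The library builds sigma-algebras on pointed types
   only, which is why nonemptiness is carried by the structure. *)
#[short(type="pmetricType")]
HB.structure Definition PointedMetric (R : numDomainType) :=
  {T of Metric R T & Pointed T}.

(* C(Omega). Compactness is a parameter of the type because the supremum norm
   below is a norm only for bounded functions. *)
Definition contSpace (R : realType) (Omega : pmetricType R)
    (cO : compact [set: Omega]) : Type := continuousType Omega R.

Section ContSpace.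
Context (R : realType) (Omega : pmetricType R) (cO : compact [set: Omega]).

Definition contPred : {pred Omega -> R} :=
  mem [set f : Omega -> R | continuous f].
Definition contPred_key : pred_key contPred. Proof. exact. Qed.
Canonical contPred_keyed := KeyedPred contPred_key.

Definition contVal (f : contSpace cO) : Omega -> R :=
  (f : continuousType Omega R).

Coercion contVal : contSpace >-> Funclass.

Lemma contVal_continuous (f : contSpace cO) : continuous (contVal f).
Proof. exact: cts_fun. Qed.

Definition contSub (f : Omega -> R) (fP : f \in contPred) : contSpace cO :=
  (mkcts (set_mem fP) : continuousType Omega R).

Lemma contSub_rect (K : contSpace cO -> Type) :
  (forall f (Pf : f \in contPred), K (contSub Pf)) -> forall u, K u.
Proof.
move=> Ksub [f [[Pf]]].
have -> : Pf = set_mem (@mem_set _ [set g : Omega -> R | continuous g] f Pf).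
  exact: Prop_irrelevance.
exact: Ksub.
Qed.

Lemma contSubK (f : Omega -> R) (Pf : f \in contPred) : contVal (contSub Pf) = f.
Proof. by []. Qed.

HB.instance Definition _ :=
  @isSub.Build _ contPred (contSpace cO) contVal contSub contSub_rect contSubK.
HB.instance Definition _ := [Choice of contSpace cO by <:].

Lemma contPred_submod_closed : submod_closed contPred.
Proof.
split=> [|a f g]; rewrite !inE /=; first by move=> x; exact: cvg_cst.
move=> cf cg x; apply: (@cvgD _ R^o); last exact: cg.
by apply: (@cvgZr _ R^o); exact: cf.
Qed.

HB.instance Definition _ :=
  GRing.isSubmodClosed.Build R (Omega -> R) contPred contPred_submod_closed.
HB.instance Definition _ := [SubChoice_isSubLmodule of contSpace cO by <:].

Definition supNorm (f : contSpace cO) : R := sup (range (fun w => `|f w|)).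

Lemma supNorm_has_sup (f : contSpace cO) : has_sup (range (fun w => `|f w|)).
Proof.
apply: compact_has_sup; first by exists `|f point|; exists point.
apply: continuous_compact => //; apply: continuous_subspaceT => x.
by apply: cvg_norm; exact: contVal_continuous.
Qed.

Lemma supNorm_ub (f : contSpace cO) w : `|f w| <= supNorm f.
Proof. by apply: (sup_upper_bound (supNorm_has_sup f)); exists w. Qed.

Lemma supNorm_le (f : contSpace cO) (M : R) :
  (forall w, `|f w| <= M) -> supNorm f <= M.
Proof.
move=> fM; apply: ge_sup; first by exists `|f point|; exists point.
by move=> _ [w _ <-].
Qed.

Lemma supNormD (f g : contSpace cO) : supNorm (f + g) <= supNorm f + supNorm g.
Proof.
by apply: supNorm_le => w; rewrite (le_trans (ler_normD _ _))// lerD// supNorm_ub.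
Qed.

Lemma supNorm_eq0 (f : contSpace cO) : supNorm f = 0 -> f = 0.
Proof.
move=> f0; apply/val_inj/funext => w /=.
by apply/eqP; rewrite -normr_le0 -f0 supNorm_ub.
Qed.

Lemma supNormZ (a : R) (f : contSpace cO) : supNorm (a *: f) = `|a| * supNorm f.
Proof.
have le (b : R) (g : contSpace cO) : supNorm (b *: g) <= `|b| * supNorm g.
  by apply: supNorm_le => w; rewrite normrM ler_wpM2l// supNorm_ub.
apply/eqP; rewrite eq_le le/=.
have [->|a0] := eqVneq a 0.
  by rewrite normr0 mul0r (le_trans (normr_ge0 _) (supNorm_ub _ point)).
rewrite -ler_pdivlMl ?normr_gt0// -normfV.
by rewrite (le_trans _ (le _ _))// scalerA mulVf// scale1r.
Qed.

HB.instance Definition _ :=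
  @Lmodule_isNormed.Build R (contSpace cO) supNorm supNormD supNormZ supNorm_eq0.

End ContSpace.

Definition convex_cone (R : realType) (V : lmodType R) (K : set V) : Prop :=
  K !=set0 /\
  forall (a b : R) (x y : V), 0 <= a -> 0 <= b -> K x -> K y ->
    K (a *: x + b *: y).

Section NoFreeLunch.
Context (R : realType) (Omega : pmetricType R) (cO : compact [set: Omega]).

Definition contPos : set (contSpace cO) := [set f | forall w, 0 <= f w].

Definition cone_minus_pos (K0 : set (contSpace cO)) : set (contSpace cO) :=
  [set f - g | f in K0 & g in contPos].

Definition NFL (K0 : set (contSpace cO)) : Prop :=
  closure (cone_minus_pos K0) `&` contPos = [set 0].

Definition borelType : Type := g_sigma_algebraType (@open Omega).

HB.instance Definition _ := Measurable.on borelType.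

Definition separating_measure (Q : probability borelType R)
    (C : set (contSpace cO)) : Prop :=
  forall X, C X -> ('E_Q[X] <= 0)%E.

Definition msupport (Q : probability borelType R) : set Omega :=
  [set w | forall U : set Omega, open U -> U w -> (0 < Q U)%E].

End NoFreeLunch.

(* Main.v *)
(* NFL to measure: if g >= 0 is not 0, NFL makes the superhedging price
   p(X) = inf {t | X <= k + t for some k in K0} finite, sublinear and positive at g.
   A linear functional below p is automatically positive, normalised and nonpositive on
   K0, and Hahn-Banach gives one that is positive at g. Doing this for countably many g
   whose cozero sets form a base of the topology, and averaging with weights 2^-(n+1),
   yields one functional that is positive on each of them; the measure representing it
   (Riesz-Markov) is separating and has full support.

   Measure to NFL: integration against a separating measure is nonpositive on the closure
   of C, so a nonnegative X in the closure has integral 0, and vanishes by full support. *)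

From HB Require Import structures.
Require Import Defs.
From mathcomp Require Import all_boot all_order all_algebra.
From mathcomp Require Import all_classical all_reals all_analysis.
From mathcomp Require Import measurable_realfun ring lra.

Import Order.TTheory GRing.Theory Num.Theory.
Import numFieldNormedType.Exports.

Local Open Scope classical_set_scope.
Local Open Scope ring_scope.

(** * Linear and sublinear functionals *)

Definition is_linear (R : realType) (V : lmodType R) (f : V -> R) :=
  forall a x y, f (a *: x + y) = a * f x + f y.
Arguments is_linear {R V} f.

Section IsLinear.
Context {R : realType} {V : lmodType R} (f : V -> R).
Context (fl : is_linear f).

Lemma is_linearD x y : f (x + y) = f x + f y.
Proof. by have := fl 1 x y; rewrite scale1r mul1r. Qed.

Lemma is_linear0 : f 0 = 0.
Proof. by have := is_linearD 0 0; rewrite addr0; lra. Qed.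

Lemma is_linearZ a x : f (a *: x) = a * f x.
Proof. by have := fl a x 0; rewrite !addr0 is_linear0 addr0. Qed.

Lemma is_linearN x : f (- x) = - f x.
Proof. by rewrite -scaleN1r is_linearZ mulN1r. Qed.

End IsLinear.

(** The weights [2^-(n+1)] sum to 1, so an upper bound common to all [f n] passes to the average.
    The pointwise bound [N] makes the weighted series converge absolutely. *)
Lemma linear_average (R : realType) (V : lmodType R) (N : V -> R)
    (f : nat -> V -> R) :
  (forall n, is_linear (f n)) -> (forall n x, `|f n x| <= N x) ->
  exists g : V -> R, [/\ is_linear g,
    forall c x, (forall n, f n x <= c) -> g x <= c &
    forall m x, (forall n, 0 <= f n x) -> 0 < f m x -> 0 < g x].
Proof.
move=> fl fN; pose w : R^nat := geometric 2^-1 2^-1.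
have half1 : `|2^-1 : R| < 1 by rewrite ger0_norm; lra.
have w0 n : 0 < w n by rewrite /w /= mulr_gt0 ?exprn_gt0 ?invr_gt0.
have cw : cvgn (series w) by exact: is_cvg_geometric_series.
have limw : limn (series w) = 1.
  have -> : (1 : R) = 2^-1 * (1 - 2^-1)^-1 by field.
  by apply/cvg_lim => //; exact: cvg_geometric_series.
pose u x : R^nat := fun n => w n * f n x.
have cwc (c : R) : cvgn (series (fun n => w n * c)).
  have -> : (fun n => w n * c) = c *: w by apply/funext => n; rewrite mulrC.
  exact: is_cvg_seriesZ.
have cu x : cvgn (series (u x)).
  apply: normed_cvg; apply: (series_le_cvg _ _ _ (cwc (N x))) => n /=.
  - exact: normr_ge0.
  - by apply: mulr_ge0; [exact/ltW|exact: le_trans (fN n x)].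
  - by rewrite /u normrM (ger0_norm (ltW (w0 n))) ler_wpM2l// ltW.
exists (fun x => limn (series (u x))); split=> [a x y|c x fc|m x f0 fm].
- have -> : u (a *: x + y) = a *: u x + u y.
    by apply/funext => n; rewrite /u fl; change (w n * (a * f n x + f n y) =
      a * (w n * f n x) + w n * f n y); ring.
  rewrite lim_seriesD//; last exact: is_cvg_seriesZ.
  by rewrite lim_seriesZ.
- have <- : limn (series (fun n => w n * c)) = c.
    have -> : (fun n => w n * c) = c *: w by apply/funext => n; rewrite mulrC.
    by rewrite lim_seriesZ// limw; exact: mulr1.
  by apply: lim_series_le => // n; rewrite ler_wpM2l// ltW.
(* The partial sum that includes index [m] is already positive, and it bounds the limit from below
   because all terms at [x] are nonnegative. *)
- apply: (@lt_le_trans _ _ (series (u x) m.+1)).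
    rewrite /series /= big_nat_recr//=.
    apply: ltr_wpDl; last by rewrite mulr_gt0.
    by apply: sumr_ge0 => i _; rewrite mulr_ge0// ltW.
  apply: nondecreasing_cvgn_le => //; apply/nondecreasing_seqP => n.
  by rewrite /series /= big_nat_recr//= lerDl mulr_ge0// ltW.
Qed.

(** * Hahn-Banach through minimal sublinear functionals *)

Section HahnBanach.
Context {R : realType} {V : lmodType R}.
Implicit Types (p q : V -> R) (x y z : V) (a b t : R).

(** Homogeneity is asked only as an inequality for [a > 0], which is easy to check for infima;
    applied to [a^-1] as well, it gives equality. *)
Definition sublinear p :=
  (forall x y, p (x + y) <= p x + p y) /\
  (forall a x, 0 < a -> p (a *: x) <= a * p x).

Lemma sublinear0 p : sublinear p -> p 0 = 0.
Proof.
move=> [pD pZ].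
have := pD 0 0; rewrite addr0 => h1.
have := pZ 2^-1 0; rewrite invr_gt0 ltr0n scaler0 => /(_ isT) h2.
lra.
Qed.

Lemma sublinearZ p a x : sublinear p -> 0 <= a -> p (a *: x) = a * p x.
Proof.
move=> sp; rewrite le_eqVlt => /predU1P[<-|a0].
  by rewrite scale0r mul0r sublinear0.
apply/eqP; rewrite eq_le sp.2//=.
rewrite -ler_pdivlMl// -[in leLHS](scale1r x) -(mulVf (lt0r_neq0 a0)) -scalerA.
by rewrite sp.2// invr_gt0.
Qed.

Lemma sublinear_ge p x : sublinear p -> - p (- x) <= p x.
Proof.
move=> sp; have := sp.1 x (- x); rewrite subrr sublinear0//; lra.
Qed.

(** With [s = t^-1] the expression is [(p (y + s x) - p y) / s], so for sublinear [p] this is the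
    one-sided derivative of [p] at [y] in direction [x]. *)
Definition directional p y x :=
  inf [set p (x + t *: y) - t * p y | t in [set t | 0 <= t]].

Lemma directional_has_inf p y x : sublinear p ->
  has_inf [set p (x + t *: y) - t * p y | t in [set t | 0 <= t]].
Proof.
move=> sp; split; first by exists (p (x + 0 *: y) - 0 * p y); exists 0 => /=.
exists (- p (- x)) => _ [t /= t0 <-].
(* Writing [t y] as [(x + t y) - x] gives a lower bound independent of [t]. *)
have := sp.1 (x + t *: y) (- x); rewrite addrAC subrr add0r sublinearZ//; lra.
Qed.

Lemma directional_le p y x t : sublinear p -> 0 <= t ->
  directional p y x <= p (x + t *: y) - t * p y.
Proof.
by move=> sp t0; apply: (ge_inf (directional_has_inf p y x sp).2); exists t.
Qed.

Lemma le_directional p y x b : sublinear p ->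
  (forall t, 0 <= t -> b <= p (x + t *: y) - t * p y) -> b <= directional p y x.
Proof.
move=> sp H; apply: lb_le_inf; first exact: (directional_has_inf p y x sp).1.
by move=> _ [t /= t0 <-]; exact: H.
Qed.

Lemma directional_sublinear p y : sublinear p -> sublinear (directional p y).
Proof.
move=> sp; split.
  move=> x z.
  rewrite -lerBlDr; apply: le_directional => // s s0.
  rewrite lerBlDr -lerBlDl; apply: le_directional => // t t0.
  rewrite lerBlDl.
  (* Parameters [s] for [z] and [t] for [x], or the reverse, combine to [s + t] for the sum. *)
  have := directional_le p y (x + z) (s + t) sp (addr_ge0 s0 t0).
  have := sp.1 (x + s *: y) (z + t *: y); rewrite addrACA -scalerDl; lra.
move=> a x a0; rewrite -ler_pdivrMl//.
apply: le_directional => // t t0; rewrite ler_pdivrMl//.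
have := directional_le p y (a *: x) (a * t) sp (mulr_ge0 (ltW a0) t0).
by rewrite -scalerA -scalerDr (sublinearZ p) ?(ltW a0)// mulrBr mulrA.
Qed.

Lemma directional_le_self p y x : sublinear p -> directional p y x <= p x.
Proof.
by move=> sp; have := directional_le p y x 0 sp (lexx _);
  rewrite scale0r addr0 mul0r subr0.
Qed.

(** Zorn's lemma for the reversed pointwise order. A nonempty chain is bounded by its pointwise
    infimum, which is finite because every [q] below [p] satisfies [- p (- x) <= q x]. *)
Lemma minimal_sublinear p : sublinear p -> exists2 q,
  sublinear q /\ (forall x, q x <= p x) &
  forall r, sublinear r -> (forall x, r x <= q x) -> r = q.
Proof.
move=> sp.
pose T := {q : V -> R | sublinear q /\ forall x, q x <= p x}.
pose ge (q r : T) := `[< forall x, sval r x <= sval q x >].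
have [q|q r s /asboolP qr /asboolP rs|[q ?] [r ?] /asboolP/= qr /asboolP/= rq|
  A Atot|] := @Zorn T ge.
- by apply/asboolP.
- by apply/asboolP => x; exact: le_trans (rs x) (qr x).
- by apply: eq_exist; apply/funext => x; apply/eqP; rewrite eq_le qr rq.
- have [[a Aa]|A0] := pselect (A !=set0); last first.
    exists (exist _ p (conj sp (fun=> lexx _)) : T) => s As; case: A0.
    by exists s.
  pose S x := [set sval q x | q in A].
  have lbS x : has_inf (S x).
    split; first by exists (sval a x); exists a.
    exists (- p (- x)) => _ [[q [sq qp]]/= Aq <-].
    by apply: le_trans (sublinear_ge q x sq); rewrite lerN2.
  have infS x (q : T) : A q -> inf (S x) <= sval q x.
    by move=> Aq; apply: (ge_inf (lbS x).2); exists q.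
  have leS x b : (forall q : T, A q -> b <= sval q x) -> b <= inf (S x).
    move=> H; apply: lb_le_inf; first exact: (lbS x).1.
    by move=> _ [q Aq <-]; exact: H.
  have sS : sublinear (fun x => inf (S x)).
    split=> [x y|c x c0].
      rewrite -lerBlDr; apply/leS => q Aq.
      rewrite lerBlDr -lerBlDl; apply/leS => r Ar; rewrite lerBlDl.
      have [/asboolP rq|/asboolP qr] := Atot _ _ Aq Ar.
        rewrite (le_trans (infS _ _ Ar))//.
        by rewrite (le_trans ((svalP r).1.1 _ _))// lerD2r.
      rewrite (le_trans (infS _ _ Aq))//.
      by rewrite (le_trans ((svalP q).1.1 _ _))// lerD2l.
    rewrite -ler_pdivrMl//; apply/leS => q Aq; rewrite ler_pdivrMl//.
    by rewrite (le_trans (infS _ _ Aq))// (svalP q).1.2.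
  have Sp x : inf (S x) <= p x.
    by rewrite (le_trans (infS _ _ Aa))// (svalP a).2.
  by exists (exist _ _ (conj sS Sp) : T) => s As; apply/asboolP => x; exact: infS.
- move=> [q [sq qp]] qmax; exists q => // r sr rq.
  have rp x : r x <= p x by rewrite (le_trans (rq x)).
  have := qmax (exist _ r (conj sr rp) : T).
  by move=> /(_ _)/(congr1 sval)/= ->//; apply/asboolP.
Qed.

(* A minimal sublinear [q] equals each of its directional derivatives, whence
   [q x <= q (x + z) - q z] and [q] is additive. Minimising below the derivative of
   [p] at [y], rather than below [p], forces the value [p y] at [y]. *)
Theorem hahn_banach_sublinear p y : sublinear p -> exists f : V -> R,
  [/\ is_linear f,
      forall x, f x <= p x & p y <= f y].
Proof.
move=> sp.
have [q [sq qd] qmin] := minimal_sublinear _ (directional_sublinear p y sp).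
have qD x z : q (x + z) = q x + q z.
  apply/eqP; rewrite eq_le sq.1/=.
  have qz : directional q z = q.
    apply: qmin; first exact: directional_sublinear.
    by move=> u; exact: directional_le_self.
  have := directional_le q z x 1 sq ler01; rewrite qz scale1r mul1r; lra.
have qN x : q (- x) = - q x.
  by apply/eqP; rewrite -addr_eq0 -qD addNr sublinear0.
have qZ a x : q (a *: x) = a * q x.
  have [a0|a0] := leP 0 a; first exact: sublinearZ.
  by rewrite -[a]opprK scaleNr qN sublinearZ ?oppr_ge0 ?ltW// -mulNr.
exists q; split=> [a x z|x|].
- by rewrite qD qZ.
- by rewrite (le_trans (qd x))// directional_le_self.
(* At [t = 1] the bound on the derivative in direction [- y] is [p 0 - p y], so
   [q (- y) <= - p y]. *)
- have := qd (- y); have := directional_le p y (- y) 1 sp ler01.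
  rewrite scale1r addNr sublinear0// qN; lra.
Qed.

End HahnBanach.

(** * The Riesz-Markov representation theorem *)

(** The distance to the complement of [U] is 1-Lipschitz and is positive exactly on [U]. When the
    complement is empty, the constant 1 replaces it. *)
Lemma open_cozero (R : realType) (T : metricType R) (U : set T) : open U ->
  exists h : T -> R, [/\ continuous h, forall x, 0 <= h x &
    U = [set x | 0 < h x]].
Proof.
move=> oU; have [[b Ub]|UT] := pselect (~` U !=set0); last first.
  exists (cst 1); split=> [x|//|]; first exact: cvg_cst.
  by apply/seteqP; split=> x _ /=; [|apply: contrapT => Ux; apply: UT; exists x].
pose D x := [set mdist x a | a in ~` U].
have infD x : has_inf (D x).
  by split; [exists (mdist x b), b|exists 0 => _ [a _ <-]; exact: mdist_ge0].
have le_h x a : ~ U a -> inf (D x) <= mdist x a.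
  by move=> Ua; apply: (ge_inf (infD x).2); exists a.
have lip x y : inf (D x) <= mdist x y + inf (D y).
  rewrite -lerBlDl; apply: lb_le_inf; first exact: (infD y).1.
  move=> _ [a Ua <-]; rewrite lerBlDl.
  by apply: le_trans (metric_triangle _ _ _); exact: le_h.
exists (fun x => inf (D x)); split=> [x|x|].
- apply/cvgrPdist_lt => e e0; near=> y.
  have xy : mdist x y < e.
    have : ball x e y by near: y; exact: nbhsx_ballx.
    by rewrite ballEmdist.
  have := lip x y; have := lip y x; rewrite (metric_sym y x).
  by rewrite ltr_norml; lra.
- apply: lb_le_inf; first exact: (infD x).1.
  by move=> _ [a _ <-]; exact: mdist_ge0.
- apply/seteqP; split=> x /=.
    move=> Ux; have /nbhs_ballP[e /= e0 eU] : nbhs x U by exact: open_nbhs_nbhs.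
    apply: (lt_le_trans e0); apply: lb_le_inf; first exact: (infD x).1.
    move=> _ [a Ua <-]; rewrite leNgt; apply/negP => xa; apply: Ua; apply: eU.
    by rewrite ballEmdist.
  move=> h0; apply: contrapT => /(le_h x); rewrite mdistxx.
  by rewrite leNgt h0.
Unshelve. all: by end_near. Qed.

Section ContinuousOps.
Context {R : realType} {T : topologicalType}.
Implicit Types f g : T -> R.

Lemma continuous_add f g : continuous f -> continuous g -> continuous (f \+ g).
Proof. by move=> cf cg x; apply: (@cvgD _ R^o); [exact: cf|exact: cg]. Qed.

Lemma continuous_sub f g : continuous f -> continuous g -> continuous (f \- g).
Proof. by move=> cf cg x; apply: (@cvgB _ R^o); [exact: cf|exact: cg]. Qed.

Lemma continuous_mul f g : continuous f -> continuous g -> continuous (f \* g).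
Proof. by move=> cf cg x; apply: cvgM; [exact: cf|exact: cg]. Qed.

Lemma continuous_minf f g : continuous f -> continuous g ->
  continuous (fun x => Num.min (f x) (g x)).
Proof. by move=> cf cg x; apply: continuous_min; [exact: cf|exact: cg]. Qed.

Lemma continuous_sum_ord n (g : nat -> T -> R) : (forall i, continuous (g i)) ->
  continuous (fun x => \sum_(i < n) g i x).
Proof.
move=> cg; elim: n => [|n IH].
  by under eq_fun do rewrite big_ord0; move=> x; exact: cvg_cst.
by under eq_fun do rewrite big_ord_recr/=; exact: continuous_add.
Qed.

End ContinuousOps.

(** * The outer measure of a positive normalised functional *)

Section Functional.
Context {R : realType} {T : topologicalType} (L : (T -> R) -> R).
Implicit Types (f : T -> R) (a : R) (A : set T).

(** [L] takes all functions as arguments, which avoids a subtype; its values are constrained only on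
    continuous ones. *)
Definition state := [/\
  forall f g : T -> R, continuous f -> continuous g -> L (f \+ g) = L f + L g,
  forall a f, continuous f -> L (fun x => a * f x) = a * L f,
  forall f, continuous f -> (forall x, 0 <= f x) -> 0 <= L f &
  L (cst 1) = 1].

Context (HL : state).
Let cc (a : R) : continuous (cst a : T -> R). Proof. by move=> x; exact: cvg_cst. Qed.

Let LD f (g : T -> R) : continuous f -> continuous g -> L (f \+ g) = L f + L g.
Proof. by case: HL => + _ _ _; exact. Qed.
Let LZ a f : continuous f -> L (fun x => a * f x) = a * L f.
Proof. by case: HL => _ + _ _; exact. Qed.

Lemma state_cst a : L (cst a) = a.
Proof.
case: HL => _ _ _ L1; have := LZ a (cst 1) (cc 1); rewrite L1 mulr1 => La.
rewrite -[RHS]La; congr L; apply/funext => x; rewrite /= mulr1.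
Qed.

Lemma stateN f : continuous f -> L (fun x => - f x) = - L f.
Proof.
move=> cf; rewrite -mulN1r -LZ//; congr L; apply/funext => x.
by rewrite mulN1r.
Qed.

Lemma stateB f (g : T -> R) : continuous f -> continuous g -> L (f \- g) = L f - L g.
Proof.
move=> cf cg; apply/eqP; rewrite eq_sym subr_eq; apply/eqP.
rewrite -LD//; last exact: continuous_sub.
by congr L; apply/funext => x /=; rewrite subrK.
Qed.

Lemma le_state f (g : T -> R) : continuous f -> continuous g -> (forall x, f x <= g x) ->
  L f <= L g.
Proof.
move=> cf cg fg; rewrite -subr_ge0 -stateB//; case: HL => _ _ + _.
by apply=> [|x]; [exact: continuous_sub|rewrite /= subr_ge0].
Qed.

Lemma state_sum_ord n (g : nat -> T -> R) : (forall i, continuous (g i)) ->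
  L (fun x => \sum_(i < n) g i x) = \sum_(i < n) L (g i).
Proof.
move=> cg; elim: n => [|n IH].
  by under eq_fun do rewrite big_ord0; rewrite big_ord0 state_cst.
under eq_fun do rewrite big_ord_recr/=.
by rewrite LD// ?IH ?big_ord_recr//; exact: continuous_sum_ord.
Qed.

(* Covering a set by increasing sequences of continuous functions, in the manner of
   Daniell, makes countable subadditivity and the measurability of cozero sets
   independent of compactness, which is needed only for the total mass. *)
Definition rising A := [set g : nat -> T -> R |
  [/\ forall n, continuous (g n), forall n x, 0 <= g n x,
      forall x, {homo g^~ x : m n / (m <= n)%N >-> m <= n} &
      forall x, A x -> exists n, 1 <= g n x]].

(** On a rising sequence the values [L (g n)] increase, so this is their limit. *)
Definition lsup (g : nat -> T -> R) := ereal_sup (range (fun n => (L (g n))%:E)).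

Definition riesz (A : set T) := ereal_inf [set lsup g | g in rising A].

Local Open Scope ereal_scope.

Lemma le_lsup g n : (L (g n))%:E <= lsup g.
Proof. by apply: ereal_sup_ubound; exists n. Qed.

Lemma lsup_le g e : (forall n, (L (g n))%:E <= e) -> lsup g <= e.
Proof. by move=> H; apply: ge_ereal_sup => _ [n _ <-]. Qed.

Lemma riesz_le A g : rising A g -> riesz A <= lsup g.
Proof. by move=> Ag; apply: ereal_inf_lbound; exists g. Qed.

Lemma rising_cst A f : continuous f -> (forall x, 0 <= f x)%R ->
  (forall x, A x -> 1 <= f x)%R -> rising A (fun=> f).
Proof.
move=> cf f0 f1; split=> [//|//|x m n _ //|x Ax].
by exists 0%N; exact: f1.
Qed.

Lemma riesz_le_cst A f : continuous f -> (forall x, 0 <= f x)%R ->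
  (forall x, A x -> 1 <= f x)%R -> riesz A <= (L f)%:E.
Proof.
move=> cf f0 f1; apply: (le_trans (riesz_le _ _ (rising_cst _ _ cf f0 f1))).
exact: lsup_le.
Qed.

Lemma riesz_ge0 A : 0 <= riesz A.
Proof.
apply: le_ereal_inf_tmp => _ [g [cg g0 _ _] <-]; apply: (le_trans _ (le_lsup g 0)).
by rewrite lee_fin; case: HL => _ _ + _; exact.
Qed.

Lemma riesz_le1 A : riesz A <= 1.
Proof. by rewrite -(state_cst 1); apply: riesz_le_cst. Qed.

Lemma riesz_fin A : riesz A \is a fin_num.
Proof.
by rewrite ge0_fin_numE ?riesz_ge0// (le_lt_trans (riesz_le1 _))// ltry.
Qed.

Lemma riesz0 : riesz set0 = 0.
Proof.
apply/eqP; rewrite eq_le riesz_ge0 andbT.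
have := riesz_le_cst set0 (cst 0%R) (cc 0%R); rewrite state_cst; exact.
Qed.

Lemma le_riesz : {homo riesz : A B / A `<=` B >-> A <= B}.
Proof.
move=> A B AB; apply: le_ereal_inf_tmp => _ [g [cg g0 ng Bg] <-].
by apply: riesz_le; split=> // x /AB; exact: Bg.
Qed.

(** Each [F i] is covered by a sequence [g i] that is optimal up to [e / 2^(i+1)]; the diagonal sums
    of [g i n] over [i < n] then rise and cover the union. *)
Lemma riesz_sigma_subadditive : sigma_subadditive riesz.
Proof.
move=> F; apply/lee_addgt0Pr => e e0.
pose d n := (e / (2 ^ n.+1)%:R)%R.
have d0 n : (0 < d n)%R by rewrite divr_gt0// ltr0n expn_gt0.
have G n : {g | rising (F n) g /\ lsup g <= riesz (F n) + (d n)%:E}.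
  apply: cid.
  have [_ [g Fg <-] gd] := lb_ereal_inf_adherent (d0 n) (riesz_fin (F n)).
  by exists g; split=> //; exact: ltW.
pose g n := sval (G n).
have cg i m : continuous (g i m) by case: (svalP (G i)).1 => + _ _ _; exact.
have g0 i m x : (0 <= g i m x)%R by case: (svalP (G i)).1 => _ + _ _; exact.
have ng i x : {homo (g i)^~ x : m n / (m <= n)%N >-> (m <= n)%R}.
  by case: (svalP (G i)).1 => _ _ + _; exact.
have Fg i x : F i x -> exists n, (1 <= g i n x)%R.
  by case: (svalP (G i)).1 => _ _ _; exact.
apply: le_trans (epsilon_trick xpredT (fun i => riesz_ge0 (F i)) (ltW e0)).
pose h n x := (\sum_(i < n) g i n x)%R.
apply: (@le_trans _ _ (lsup h)).
  apply: riesz_le; split=> [n|n x|x m n mn|x [i _ Fix]].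
  - exact: (continuous_sum_ord n (fun i => g i n)).
  - by apply: sumr_ge0.
  - rewrite /h -(subnKC mn) big_split_ord/= -[leLHS]addr0 lerD//.
      by apply: ler_sum => i _; apply: ng; exact: leq_addr.
    exact: sumr_ge0.
  - have [n gn] := Fg _ _ Fix.
    (* Index [i.+1] is the first at which [g i] enters the sum, and from [n] on [g i] is at least 1
       at [x]. *)
    exists (maxn i.+1 n); have im : (i < maxn i.+1 n)%N by rewrite leq_max leqnn.
    rewrite /h (bigD1 (Ordinal im))//= -[leLHS]addr0 lerD//.
      by rewrite (le_trans gn)// ng// leq_maxr.
    exact: sumr_ge0.
apply: lsup_le => n.
rewrite (state_sum_ord n (fun i => g i n))// -sumEFin.
apply: le_trans; last first.
  apply: (@nneseries_lim_ge _ _ xpredT 0%N n) => i _ _.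
  by apply: adde_ge0; [exact: riesz_ge0|rewrite lee_fin; exact/ltW/d0].
rewrite big_mkord; apply: lee_sum => i _.
exact: le_trans (le_lsup _ _) (svalP (G i)).2.
Qed.

Definition riesz_outer : {outer_measure set T -> \bar R} :=
  HB.pack riesz (isOuterMeasure.Build R T riesz
    riesz0 riesz_ge0 le_riesz riesz_sigma_subadditive).

(* With [k n = min 1 (n h)], which increases to the indicator of [h > 0], a sequence
   [g] covering [X] splits into [g n * k n], covering the part of [X] where [h > 0],
   and, for each fixed [n], [g m * (1 - k n)] for [m >= n], covering the rest. *)
Lemma riesz_cozero_measurable (h : T -> R) : continuous h ->
  (forall x, 0 <= h x)%R -> riesz_outer.-caratheodory [set x | 0 < h x]%R.
Proof.
move=> ch h0; set V := [set x | _].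
apply: le_caratheodory_measurable => X; rewrite /= -!/(riesz _).
apply: le_ereal_inf_tmp => _ [g [cg g0 ng Xg] <-].
pose k n x := Num.min 1%R (n%:R * h x)%R.
have ck n : continuous (k n).
  apply: continuous_minf; first exact: cc.
  by apply: continuous_mul => //; exact: cc.
have k0 n x : (0 <= k n x)%R by rewrite le_min ler01 mulr_ge0.
have k1 n x : (k n x <= 1)%R by rewrite ge_min lexx.
have nk x : {homo k^~ x : m n / (m <= n)%N >-> (m <= n)%R}.
  move=> m n mn; rewrite /k le_min ge_min lexx/= ge_min.
  by rewrite [X in _ || X]ler_wpM2r ?orbT// ler_nat.
rewrite -leeBrDr ?riesz_fin//.
apply: (@le_trans _ _ (lsup (fun n => g n \* k n)%R)).
  apply: riesz_le; split=> [n|n x|x m n mn|x [Xx Vx]].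
  - exact: continuous_mul.
  - exact: mulr_ge0.
  - by rewrite ler_pM// ?ng ?nk.
  - have [n gn] := Xg _ Xx.
    have [N hN] : exists N, (1 <= N%:R * h x)%R.
      exists (Num.trunc (h x)^-1).+1.
      rewrite -ler_pdivrMr// div1r ltW//.
      exact: truncnS_gt.
    exists (maxn n N); rewrite /= -[leLHS]mulr1 ler_pM//.
      by rewrite (le_trans gn)// ng// leq_maxl.
    apply: (@le_trans _ _ (k N x)); first by rewrite le_min lexx.
    by rewrite nk// leq_maxr.
apply: lsup_le => n; rewrite leeBrDr ?riesz_fin//.
rewrite addeC -leeBrDr//.
pose v m := (g (n + m)%N \* (cst 1 \- k n))%R.
have cv m : continuous (v m).
  by apply: continuous_mul => //; apply: continuous_sub => //; exact: cc.
apply: (@le_trans _ _ (lsup v)).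
  apply: riesz_le; split=> // [m x|x m m' mm'|x [Xx Vx]].
  - by rewrite mulr_ge0// subr_ge0.
  - by rewrite ler_wpM2r ?subr_ge0// ng// leq_add2l.
  - have [m gm] := Xg _ Xx; exists m.
    have -> : v m x = g (n + m)%N x.
      have hx0 : h x = 0%R.
        by apply/eqP; rewrite eq_le h0 andbT leNgt; exact/negP.
      by rewrite /v /k /= hx0 mulr0 min_r ?ler01// subr0 mulr1.
    by rewrite (le_trans gm)// ng// leq_addl.
apply: lsup_le => m; rewrite leeBrDr//.
(* As [g n <= g (n + m)], the two pieces cut by the same [k n] add up to at most [g (n + m)]. *)
apply: le_trans (le_lsup g (n + m)); rewrite -EFinD lee_fin -LD//; last first.
  exact: continuous_mul.
apply: le_state => // [|x].
  by apply: continuous_add => //; exact: continuous_mul.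
have : (g n x * k n x <= g (n + m)%N x * k n x)%R.
  by rewrite ler_wpM2r// ng// leq_addr.
rewrite /v/= mulrBr mulr1; lra.
Qed.

(** A Dini argument: a rising sequence that covers a compact space exceeds [1 - e] everywhere from a
    single index on. *)
Lemma riesz_setT : compact [set: T] -> riesz [set: T] = 1.
Proof.
move=> cT; apply/eqP; rewrite eq_le riesz_le1/=.
apply: le_ereal_inf_tmp => _ [g [cg g0 ng Tg] <-].
apply/lee_addgt0Pr => e e0.
have /compact_near_coveringP cT' := cT.
have [N _ /(_ N (leqnn N)) gN] :
    \forall n \near \oo, [set: T] `<=` (fun n x => 1 - e <= g n x)%R n.
  apply: cT' => x _; have [m gm] := Tg x I.
  exists ([set y | 1 - e < g m y]%R, [set n | (m <= n)%N]) => /=.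
    split; last by exists m.
    have : nbhs (g m x) [set r | 1 - e < r]%R.
      by apply: open_nbhs_nbhs; split; [exact: open_gt|rewrite /=; lra].
    exact: (cg m x).
  by move=> [y n] /= [y1 mn]; rewrite (le_trans (ltW y1))// ng.
rewrite addeC -leeBlDl//; apply: le_trans (le_lsup g N).
rewrite -EFinB lee_fin -[leLHS]state_cst; apply: le_state => // x.
exact: gN.
Qed.

End Functional.

(** * Borel measurability and expectations of continuous functions *)

Section Borel.
Context {R : realType} {T : pmetricType R}.

Lemma borel_open (U : set (borelType T)) : open (U : set T) -> measurable U.
Proof. by move=> oU; apply: sub_sigma_algebra. Qed.

Lemma continuous_open_gt (f : T -> R) a : continuous f -> open [set x | a < f x].
Proof.
by move=> /continuousP/(_ [set r | a < r]); apply; exact: open_gt.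
Qed.

Lemma borel_gt (f : T -> R) a : continuous f ->
  measurable ([set x | a < f x] : set (borelType T)).
Proof. by move=> cf; apply: borel_open; exact: continuous_open_gt. Qed.

Lemma continuous_borel (f : T -> R) : continuous f ->
  measurable_fun [set: borelType T] f.
Proof.
move=> cf; apply: (measurability _ (RGenOInfty.measurableE R)).
move=> _ [_ [a ->] <-]; apply: measurableI => //.
have -> : f @^-1` `]a, +oo[%classic = [set x | a < f x].
  by apply/seteqP; split=> x; rewrite /= in_itv/= andbT.
exact: borel_gt.
Qed.

Context (cT : compact [set: T]).

Lemma continuous_bounded (f : T -> R) : continuous f ->
  exists2 M, 0 <= M & forall x, `|f x| <= M.
Proof.
move=> cf; have fP : f \in @contPred R T by exact/mem_set.
exists (supNorm (contSub cT fP)) => [|x]; last exact: (supNorm_ub (contSub cT fP)).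
exact: le_trans (normr_ge0 _) (supNorm_ub (contSub cT fP) point).
Qed.

Lemma continuous_integrable (P : probability (borelType T) R) (f : T -> R) :
  continuous f -> P.-integrable [set: borelType T] (EFin \o f).
Proof.
move=> cf; apply: measurable_bounded_integrable => //.
- exact: fin_num_fun_lty.
- exact: continuous_borel.
- have [M _ fM] := continuous_bounded _ cf.
  by exists M; split; [exact: num_real|move=> r Mr x _]; rewrite /= (le_trans (fM x))// ltW.
Qed.

Lemma expectation_continuous_fin (P : probability (borelType T) R) (f : T -> R) :
  continuous f -> ('E_P[f])%E \is a fin_num.
Proof.
move=> cf; rewrite unlock; apply: integrable_fin_num => //.
exact: continuous_integrable.
Qed.

Lemma expectation_continuousD (P : probability (borelType T) R) (f g : T -> R) :
  continuous f -> continuous g -> ('E_P[f \+ g] = 'E_P[f] + 'E_P[g])%E.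
Proof.
move=> cf cg; rewrite unlock -integralD//; last 2 first.
- exact: continuous_integrable.
- exact: continuous_integrable.
Qed.

Lemma expectation_cst_patch (P : probability (borelType T) R) (M : R)
    (A : set (borelType T)) : measurable A ->
  ('E_P[cst M \_ A] = M%:E * P A)%E.
Proof.
move=> mA; rewrite unlock -integral_cst// [RHS]integral_mkcond.
by apply: eq_integral => x _; rewrite !patchE; case: ifPn.
Qed.

Lemma expectation_le_cst (P : probability (borelType T) R) (f : T -> R) (M : R)
    (A : set (borelType T)) : measurable A -> continuous f ->
  (forall x, 0 <= f x) -> (forall x, A x -> f x <= M) ->
  (forall x, ~ A x -> f x = 0) -> ('E_P[f] <= M%:E * P A)%E.
Proof.
move=> mA cf f0 fM fA; rewrite -expectation_cst_patch// unlock.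
apply: ge0_le_integral => //.
- by move=> x _; rewrite lee_fin.
- by apply/measurable_EFinP; exact: continuous_borel.
- by apply/measurable_EFinP/measurable_restrict.
- move=> x _; rewrite lee_fin patchE; case: ifPn => [/set_mem/fM//|].
  by rewrite notin_setE => /fA ->.
Qed.

Lemma expectation_ge_cst (P : probability (borelType T) R) (f : T -> R) (a : R)
    (A : set (borelType T)) : measurable A -> continuous f -> 0 <= a ->
  (forall x, 0 <= f x) -> (forall x, A x -> a <= f x) ->
  (a%:E * P A <= 'E_P[f])%E.
Proof.
move=> mA cf a0 f0 fa; rewrite -expectation_cst_patch// unlock.
apply: ge0_le_integral => //.
- by move=> x _; rewrite lee_fin patchE; case: ifPn.
- by apply/measurable_EFinP/measurable_restrict.
- by apply/measurable_EFinP; exact: continuous_borel.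
- move=> x _; rewrite lee_fin patchE; case: ifPn => [/set_mem/fa//|_].
  exact: f0.
Qed.

(** This makes the calculus of states available for expectations, which can then be compared with
    [L] on equal terms. *)
Lemma expectation_continuous_state (P : probability (borelType T) R) :
  state (fun f : T -> R => fine ('E_P[f])%E).
Proof.
split=> [f g cf cg|a f cf|f cf f0|].
- by rewrite expectation_continuousD// fineD// expectation_continuous_fin.
- rewrite -[RHS]/(fine a%:E * _) -fineM// ?expectation_continuous_fin//.
  by rewrite unlock -integralZl//; exact: continuous_integrable.
- by rewrite fine_ge0// unlock; apply: integral_ge0 => x _; rewrite lee_fin.
- by rewrite expectation_cst.
Qed.

End Borel.

(** * The representing probability measure *)

Section RieszMarkov.
Context {R : realType} {T : pmetricType R} (cT : compact [set: T]).
Context (L : (T -> R) -> R) (HL : state L).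

(** The Caratheodory sets form a sigma-algebra that contains every cozero set, and in a metric space
    every open set is one. *)
Lemma borel_caratheodory (A : set (borelType T)) :
  measurable A -> (riesz_outer L HL).-caratheodory A.
Proof.
apply: smallest_sub => [|U /= /open_cozero[h [ch h0 ->]]]; last first.
  exact: riesz_cozero_measurable.
exact: (@sigma_algebra_measurable _ (caratheodory_type (riesz_outer L HL))).
Qed.

Definition riesz_measure (A : set (borelType T)) : \bar R := riesz L A.

Let riesz_measure_additive : semi_sigma_additive riesz_measure.
Proof.
move=> F mF tF mUF.
have := @caratheodory_measure_sigma_additive _ _ (riesz_outer L HL) F.
by apply=> [n||]; [exact: borel_caratheodory|exact: tF|exact: borel_caratheodory].
Qed.

HB.instance Definition _ := isMeasure.Build _ _ _ riesz_measure
  (riesz0 L HL) (riesz_ge0 L HL) riesz_measure_additive.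

HB.instance Definition _ := Measure_isProbability.Build _ _ _ riesz_measure
  (riesz_setT L HL cT).

Let Q : probability (borelType T) R := riesz_measure.

Let E (f : T -> R) := fine ('E_Q[f])%E.

Let HE : state E. Proof. exact: expectation_continuous_state. Qed.

Let cc (a : R) : continuous (cst a : T -> R). Proof. by move=> x; exact: cvg_cst. Qed.

(* Induction on [n] through [f = min f d + (f - min f d)]: the error terms
   [d * Q (f > i d)] of the successive layers telescope. *)
Lemma expectation_le_tail (f : T -> R) (d : R) n : continuous f ->
  (forall x, 0 <= f x) -> 0 < d -> (forall x, f x <= n%:R * d) ->
  E f <= L f + d * fine (Q [set x | 0 < f x]).
Proof.
move=> + + d0; elim: n f => [|n IH] f cf f0 fn.
  have -> : f = cst 0.
    by apply/funext => x; apply/eqP; rewrite eq_le f0 andbT (le_trans (fn x))// mul0r.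
  by rewrite (state_cst _ HE) (state_cst _ HL) add0r mulr_ge0// ?fine_ge0// ltW.
pose u x := Num.min (f x) d; pose v := f \- u.
have cu : continuous u by apply: continuous_minf => //; exact: cc.
have cv : continuous v by exact: continuous_sub.
have u0 x : 0 <= u x by rewrite le_min f0 ltW.
have v0 x : 0 <= v x by rewrite subr_ge0 ge_min lexx.
have fuv : f = u \+ v by apply/funext => x; rewrite /= addrC subrK.
have vn x : v x <= n%:R * d.
  have := fn x; rewrite -natr1 mulrDl mul1r /v /u /=.
  have nd0 : 0 <= n%:R * d by rewrite mulr_ge0// ltW.
  by rewrite minEle; case: ifPn; lra.
have vd : [set x | 0 < v x] = [set x | d < f x].
  apply/seteqP; split=> x; rewrite /v /u /= minEle; case: ifPn; lra.
have mgt a : measurable ([set x | a < f x] : set (borelType T)).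
  exact: borel_gt.
have Eu : E u <= d * fine (Q [set x | 0 < f x]).
  rewrite -lee_fin EFinM !fineK; last 2 first.
  - exact: fin_num_measure.
  - exact: expectation_continuous_fin.
  apply: expectation_le_cst => // [x _|x /negP].
  - by rewrite ge_min lexx orbT.
  - by rewrite -leNgt => fx; apply/eqP; rewrite eq_le u0 andbT ge_min fx.
(* This absorbs the error term of the induction hypothesis into [L u]: [d^-1 * u] is at least 1
   where [f > d], so it bounds the outer measure of that set. *)
have Lu : d * fine (Q [set x | 0 < v x]) <= L u.
  rewrite vd -ler_pdivlMl// -lee_fin fineK; last exact: fin_num_measure.
  case: (HL) => _ LZ _ _; rewrite -LZ//.
  apply: (riesz_le_cst L [set x | d < f x] (fun x => d^-1 * u x)).
  - by apply: continuous_mul => //; exact: cc.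
  - by move=> x; rewrite mulr_ge0// invr_ge0 ltW.
  - move=> x /= dfx; by rewrite /u (min_r (ltW dfx)) mulVf// lt0r_neq0.
have fE : E f = E u + E v by rewrite {1}fuv; case: HE => + _ _ _; exact.
have fL : L f = L u + L v by rewrite {1}fuv; case: HL => + _ _ _; exact.
have := IH v cv v0 vn; rewrite fE fL; lra.
Qed.

(** Adding a bound [M] of [f] moves its values into [[0, 2M]]. The error in the tail estimate is
    then at most the layer height, which is arbitrary. *)
Lemma expectation_le_state (f : T -> R) : continuous f -> E f <= L f.
Proof.
move=> cf; have [M M0 fM] := continuous_bounded cT f cf.
have pos (g : T -> R) : continuous g -> (forall x, 0 <= g x) ->
    (forall x, g x <= M + M) -> E g <= L g.
  move=> cg g0 gM; apply/ler_addgt0Pr => e e0.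
  (* Enough layers of height [e] to reach [M + M]. *)
  pose n := (Num.trunc ((M + M) / e)).+1.
  have := expectation_le_tail g e n cg g0 e0.
  have Q1 : fine (Q [set x | 0 < g x]) <= 1.
    rewrite -lee_fin fineK; last exact: fin_num_measure (borel_gt _ 0 cg).
    exact: probability_le1 (borel_gt _ 0 cg).
  move=> /(_ _)/le_trans; apply.
    move=> x; rewrite (le_trans (gM x))// -ler_pdivrMr// ltW//.
    exact: truncnS_gt.
  by rewrite lerD2l ler_piMr// ltW.
have cg : continuous (f \+ cst M) by apply: continuous_add => //; exact: cc.
have := pos _ cg.
case: HE => /(_ f (cst M) cf (cc M)) -> _ _ _.
case: HL => /(_ f (cst M) cf (cc M)) -> _ _ _.
rewrite (state_cst _ HE) (state_cst _ HL) lerD2r; apply=> x /=.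
- by have := fM x; rewrite ler_norml; lra.
- by have := fM x; rewrite ler_norml; lra.
Qed.

(** The one-sided comparison, applied to both [f] and [- f], gives equality. *)
Theorem riesz_markov : exists P : probability (borelType T) R,
  forall f : T -> R, continuous f -> ('E_P[f] = (L f)%:E)%E.
Proof.
exists Q => f cf.
rewrite -[LHS]fineK ?expectation_continuous_fin//; congr EFin.
have cNf : continuous (fun x => - f x) by move=> x; apply: (@cvgN _ R^o); exact: cf.
apply/eqP; rewrite eq_le expectation_le_state//=.
have := expectation_le_state _ cNf.
by rewrite (stateN _ HE)// (stateN _ HL)// lerN2.
Qed.

End RieszMarkov.

(** * The Kreps-Yan argument *)

Section Cont.
Context {R : realType} {Omega : pmetricType R} (cO : compact [set: Omega]).
Local Notation V := (contSpace cO).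
Implicit Types (X Y k g : V).

Definition mkcont (f : Omega -> R) (cf : continuous f) : V :=
  contSub cO (mem_set cf : f \in @contPred R Omega).

Definition cont1 : V := mkcont (cst 1) (fun x => @cvg_cst _ _ _ _ _).

Lemma contD X Y w : contVal (X + Y) w = X w + Y w. Proof. by []. Qed.
Lemma contB X Y w : contVal (X - Y) w = X w - Y w. Proof. by []. Qed.
Lemma contZ a X w : contVal (a *: X) w = a * X w. Proof. by []. Qed.

Lemma cont1E w : cont1 w = 1. Proof. by []. Qed.

(** A compact metric space has a countable base. Index [n] gets a function whose cozero set is the
    nonempty base set with code [n] under [j], or [cont1] if there is none, so that no [h n]
    vanishes. *)
Lemma contPos_cozero_base : exists h : nat -> V,
  [/\ forall n, contPos (h n), forall n, h n <> 0 &
    forall U w, open U -> U w -> exists n, [set x | 0 < h n x] `<=` U].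
Proof.
have [B /countable_injP[j jinj] [Bo Bb]] := compact_second_countable cO.
have H n : exists g : V, [/\ contPos g, g <> 0 &
    forall U, B U -> U !=set0 -> j U = n -> [set x | 0 < g x] = U].
  have [[U [BU [x Ux] jU]]|nU] :=
      pselect (exists U, [/\ B U, U !=set0 & j U = n]); last first.
    exists cont1; split=> [x|/(congr1 (fun g : V => g point))/eqP|U BU U0 jU].
    - exact: ler01.
    - by rewrite /= oner_eq0.
    - by case: nU; exists U.
  have [f [cf f0 Uf]] := open_cozero _ _ _ (Bo _ BU).
  exists (mkcont f cf); split=> [//|f00|U' BU' _ jU'].
  - have fx0 : f x = 0 by exact: (congr1 (fun g : V => g x) f00).
    by move: Ux; rewrite Uf /= fx0 ltxx.
  - by rewrite -[LHS]Uf; apply: jinj; rewrite ?inE// jU jU'.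
have [h hP] := choice H.
exists h; split=> [n|n|U w oU Uw]; [by case: (hP n)|by case: (hP n)|].
have [W [BW Ww] WU] := Bb w _ (open_nbhs_nbhs (conj oU Uw)).
by exists (j W); case: (hP (j W)) => _ _ /(_ W BW) -> //; exists w.
Qed.

Context (K0 : set V) (coneK0 : convex_cone K0).

Lemma cone0 : K0 0.
Proof.
have [[x Kx] Kc] := coneK0.
by have := Kc 0 0 x x (lexx 0) (lexx 0) Kx Kx; rewrite !scale0r addr0.
Qed.

Lemma coneD X Y : K0 X -> K0 Y -> K0 (X + Y).
Proof.
move=> KX KY; have := coneK0.2 1 1 X Y ler01 ler01 KX KY.
by rewrite !scale1r.
Qed.

Lemma coneZ a X : 0 <= a -> K0 X -> K0 (a *: X).
Proof.
move=> a0 KX; have := coneK0.2 a 0 X X a0 (lexx 0) KX KX.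
by rewrite scale0r addr0.
Qed.

Definition superhedging X :=
  [set t | exists2 k, K0 k & forall w, X w <= k w + t].

Lemma closure_contP (C : set V) X : closure C X <->
  forall e, 0 < e -> exists2 Y, C Y & forall w, `|X w - Y w| <= e.
Proof.
split=> [clX e e0|H B /nbhs_ballP[e /= e0 eB]].
  have [Y [CY XY]] := clX _ (nbhsx_ballx X e e0).
  exists Y => // w; move: XY; rewrite -ball_normE /= => XY.
  by apply: le_trans (ltW XY); exact: (supNorm_ub (X - Y) w).
(* Halving turns the weak pointwise bound into the strict one that the open ball requires. *)
have e20 : 0 < e / 2 by rewrite divr_gt0.
have [Y CY XY] := H _ e20; exists Y; split=> //; apply: eB.
rewrite -ball_normE /=; apply: (@le_lt_trans _ _ (e / 2)); last by lra.
exact: (@supNorm_le _ _ _ (X - Y) _ XY).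
Qed.

Context (nfl : NFL K0).

(** The function [g - e] lies below [k], hence in [cone_minus_pos K0], at distance [e] from [g]; so
    [g] is in the closure. *)
Lemma nfl_closure g : contPos g ->
  (forall e, 0 < e -> exists2 k, K0 k & forall w, g w <= k w + e) -> g = 0.
Proof.
move=> g0 H; suff : [set 0] g by [].
rewrite -nfl; split=> //; apply/closure_contP => e e0.
have [k Kk gk] := H e e0.
exists (g - e *: cont1).
  exists k => //; exists (k - (g - e *: cont1)); last by rewrite opprB addrC subrK.
  by move=> w; have := gk w; rewrite !contB contZ cont1E mulr1; lra.
by move=> w; rewrite contB contZ cont1E mulr1 opprB addrC subrK ger0_norm// ltW.
Qed.

Lemma cont1_neq0 : cont1 <> 0.
Proof.
by move=> /(congr1 (fun g : V => g point))/eqP; rewrite /= oner_eq0.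
Qed.

(** If [t] were smaller, the hedge [k] would be at least [d = - supNorm X - t > 0] everywhere. Then
    [d^-1 *: k] dominates 1, a free lunch. *)
Lemma superhedging_lb X t : superhedging X t -> - supNorm X <= t.
Proof.
move=> [k Kk Xk]; rewrite leNgt; apply/negP => tX.
pose d := - supNorm X - t; have d0 : 0 < d by rewrite subr_gt0.
apply: cont1_neq0; apply: nfl_closure => [w|e e0]; first exact: ler01.
exists (d^-1 *: k); first by apply: coneZ => //; rewrite invr_ge0 ltW.
move=> w; rewrite contZ cont1E.
have : d^-1 * d <= d^-1 * k w.
  rewrite ler_pM2l ?invr_gt0// /d; have := Xk w.
  have := supNorm_ub X w; rewrite ler_norml; lra.
rewrite mulVf ?lt0r_neq0//; lra.
Qed.

Lemma superhedging_has_inf X : has_inf (superhedging X).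
Proof.
split; last by exists (- supNorm X) => t; exact: superhedging_lb.
exists (supNorm X); exists 0; first exact: cone0.
move=> w; have := supNorm_ub X w; rewrite ler_norml /= add0r; lra.
Qed.

Definition superprice X := inf (superhedging X).

Lemma superprice_le X t : superhedging X t -> superprice X <= t.
Proof. by move=> Xt; exact: (ge_inf (superhedging_has_inf X).2). Qed.

Lemma le_superprice X b : (forall t, superhedging X t -> b <= t) ->
  b <= superprice X.
Proof.
by move=> H; apply: lb_le_inf; [exact: (superhedging_has_inf X).1|exact: H].
Qed.

Lemma superprice_sublinear : sublinear superprice.
Proof.
split=> [X Y|a X a0].
  rewrite -lerBlDr; apply: le_superprice => s [k Kk Xk].
  rewrite lerBlDr -lerBlDl; apply: le_superprice => t [l Kl Yl].
  rewrite lerBlDl; apply: superprice_le; exists (k + l); first exact: coneD.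
  by move=> w; have := Xk w; have := Yl w; rewrite !contD; lra.
rewrite -ler_pdivrMl//; apply: le_superprice => s [k Kk Xk].
rewrite ler_pdivrMl//; apply: superprice_le.
exists (a *: k); first by apply: coneZ => //; exact: ltW.
by move=> w; rewrite !contZ -mulrDr ler_pM2l.
Qed.

Definition pricing (f : V -> R) := [/\ is_linear f,
  forall X, contPos X -> 0 <= f X, f cont1 = 1 & forall X, K0 X -> f X <= 0].

(** Each clause of [pricing] follows from [f <= superprice] and an explicit hedge: 0 without cash
    for [- X] with [X >= 0], cash alone for 1 and -1, and [X] itself for [X] in [K0]. *)
Lemma kreps_yan g : contPos g -> g <> 0 -> exists2 f, pricing f & 0 < f g.
Proof.
move=> g0 gn0.
have [f [fl fp gf]] := hahn_banach_sublinear _ g superprice_sublinear.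
have fle X t : superhedging X t -> f X <= t.
  by move=> /superprice_le; exact: le_trans.
exists f.
  split=> // [X X0||X KX].
  - rewrite -oppr_le0 -(is_linearN _ fl); apply: fle.
    exists 0; first exact: cone0.
    by move=> w; rewrite /= addr0 oppr_le0.
  - apply/eqP; rewrite eq_le; apply/andP; split.
      apply: fle; exists 0; first exact: cone0.
      by move=> w; rewrite /= add0r.
    rewrite -lerN2 -(is_linearN _ fl); apply: fle; exists 0; first exact: cone0.
    by move=> w; rewrite /= add0r.
  - by apply: fle; exists X => // w; rewrite addr0.
(* If the price of [g] were at most 0, then [g] could be superhedged with cash below any [e > 0], so
   [g] would be 0. *)
apply: lt_le_trans gf; rewrite ltNge; apply/negP => pg.
apply: gn0; apply: nfl_closure => // e e0.
have [t [k Kk gk] te] := inf_adherent e0 (superhedging_has_inf g).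
exists k => // w; have := gk w; move: te pg; rewrite /superprice; lra.
Qed.

(** Positivity at [supNorm X *: cont1 - Y] for [Y = X] and [Y = - X]. This is the common bound that
    [linear_average] requires. *)
Lemma pricing_bounded f X : pricing f -> `|f X| <= supNorm X.
Proof.
move=> [fl f0 f1 _].
have H Y : (forall w, `|Y w| <= supNorm X) -> f Y <= supNorm X.
  move=> YX; have : 0 <= f (supNorm X *: cont1 - Y).
    apply: f0 => w; rewrite contB contZ cont1E mulr1 subr_ge0.
    by rewrite (le_trans (ler_norm _)).
  by rewrite is_linearD// is_linearN// is_linearZ// f1 mulr1 subr_ge0.
rewrite ler_norml lerNl -is_linearN//; apply/andP; split; apply: H => w.
  by rewrite /= normrN supNorm_ub.
exact: supNorm_ub.
Qed.

(** Every clause of [pricing] besides linearity can be phrased through upper bounds shared by all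
    [f n], normalisation through the bounds at 1 and -1, so it survives averaging. *)
Lemma strictly_positive_pricing : exists2 f, pricing f &
  forall U w, open U -> U w ->
    exists g, [/\ contPos g, 0 < f g & [set x | 0 < g x] `<=` U].
Proof.
have [h [h0 hn0 hU]] := contPos_cozero_base.
have /choice[f fP] n : exists f : V -> R, pricing f /\ 0 < f (h n).
  by have [f ? ?] := kreps_yan _ (h0 n) (hn0 n); exists f.
have fl n : is_linear (f n) by case: (fP n) => -[].
have fpos n X : contPos X -> 0 <= f n X by case: (fP n) => -[_ + _ _] _; exact.
have f1 n : f n cont1 = 1 by case: (fP n) => -[].
have fK n X : K0 X -> f n X <= 0 by case: (fP n) => -[_ _ _ +] _; exact.
have [F [Fl Fle Fgt]] := linear_average _ _ (@supNorm _ _ _) f fl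
  (fun n X => pricing_bounded (f n) X (fP n).1).
exists F.
  split=> // [X X0||X KX].
  - rewrite -oppr_le0 -is_linearN//; apply: Fle => n.
    by rewrite is_linearN// oppr_le0 fpos.
  - apply/eqP; rewrite eq_le Fle ?andTb => [|n]; last by rewrite f1.
    by rewrite -lerN2 -is_linearN//; apply: Fle => n; rewrite is_linearN// f1.
  - by apply: Fle => n; exact: fK.
move=> U w oU Uw; have [n hnU] := hU U w oU Uw.
exists (h n); split=> //; apply: (Fgt n); last exact: (fP n).2.
by move=> m; exact: fpos.
Qed.

End Cont.

(** * The two implications *)

Section NFLSeparating.
Context {R : realType} {Omega : pmetricType R} (cO : compact [set: Omega]).
Context (K0 : set (contSpace cO)) (coneK0 : convex_cone K0).
Local Notation V := (contSpace cO).

Lemma separating_NFL (Q : probability (borelType Omega) R) :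
  separating_measure Q (cone_minus_pos K0) -> msupport Q = [set: Omega] ->
  NFL K0.
Proof.
move=> sepQ suppQ; have HE := expectation_continuous_state cO Q.
apply/seteqP; split=> [X [clX X0]|_ ->]; last first.
  split; last by move=> w.
  apply: subset_closure; exists 0; first exact: cone0.
  by exists 0; [move=> w|rewrite subr0].
have cX := @contVal_continuous _ _ _ X.
have EX0 : fine ('E_Q[contVal X])%E <= 0.
  (* An element [Y] of the cone within [e] of [X] gives [X <= Y + e], so the expectation of [X] is
     at most [e]. *)
  apply/ler_addgt0Pr => e e0; rewrite add0r.
  have [Y CY XY] := (closure_contP cO _ _).1 clX e e0.
  have cY := @contVal_continuous _ _ _ Y.
  have ce : continuous (cst e : Omega -> R) by move=> x; exact: cvg_cst.
  have := le_state _ HE _ (contVal Y \+ cst e) cX (continuous_add _ _ cY ce).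
  case: (HE) => HD _ _ _; rewrite HD// (state_cst _ HE).
  move=> /(_ _)/le_trans; apply.
    by move=> w; have := XY w; rewrite ler_norml /=; lra.
  rewrite gerDr -lee_fin fineK; first exact: sepQ.
  exact: expectation_continuous_fin.
apply: contrapT => /= Xn0.
have [w Xw] : exists w, X w != 0.
  apply: contrapT => nX; apply: Xn0; apply: val_inj; apply/funext => w /=.
  by apply: contrapT => /eqP Xw; apply: nX; exists w.
have {}Xw : 0 < X w by rewrite lt_neqAle eq_sym Xw X0.
(* The open set where [X > X w / 2] contains [w], so it has positive mass and forces a positive
   expectation. *)
have oU := continuous_open_gt _ (X w / 2) cX.
have QU : (0 < Q [set x | X w / 2 < X x]%R)%E.
  have : msupport Q w by rewrite suppQ.
  by apply=> //=; lra.
have mU := borel_gt _ (X w / 2) cX.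
have := expectation_ge_cst Q X (X w / 2) _ mU cX.
move=> /(_ _ X0 (fun x h => ltW h)) H.
have : (0 < (X w / 2)%:E * Q [set x | X w / 2 < X x]%R)%E.
  by rewrite mule_gt0// lte_fin divr_gt0.
apply/negP; rewrite -leNgt (le_trans (H _))//; first by rewrite divr_ge0// ltW.
by rewrite -[leLHS]fineK ?lee_fin// expectation_continuous_fin.
Qed.

Lemma NFL_separating : NFL K0 -> exists Q : probability (borelType Omega) R,
  separating_measure Q (cone_minus_pos K0) /\ msupport Q = [set: Omega].
Proof.
move=> nfl; have [f [fl f0 f1 fK] fU] := strictly_positive_pricing cO K0 coneK0 nfl.
(* [insubd] extends [f] to all functions by sending discontinuous ones to 0; [state] only looks at
   continuous ones. *)
pose L (g : Omega -> R) : R := f (insubd (0 : V) g).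
have LV (X : V) : L X = f X by rewrite /L valKd.
have LE g (cg : continuous g) : L g = f (mkcont cO g cg) by rewrite -LV.
have HL : state L.
  split=> [g h cg ch|a g cg|g cg g0|].
  - by rewrite (LE _ cg) (LE _ ch) -is_linearD// -LV.
  - by rewrite (LE _ cg) -is_linearZ// -LV.
  - by rewrite (LE _ cg); exact: f0.
  - by rewrite -[RHS]f1 -LV.
have [Q QL] := riesz_markov cO L HL.
have QV (X : V) : ('E_Q[contVal X] = (f X)%:E)%E.
  by rewrite QL ?LV//; exact: contVal_continuous.
exists Q; split=> [_ [k Kk [g g0 <-]]|].
  rewrite QV lee_fin is_linearD// is_linearN//.
  by have := fK k Kk; have := f0 g g0; lra.
apply/seteqP; split=> // w _ U oU Uw; have [g [g0 fg gU]] := fU U w oU Uw.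
rewrite lt0e measure_ge0 andbT; apply/eqP => QU.
(* As [g] vanishes off [U], a null [U] would make its expectation at most 0, against [0 < f g]. *)
suff : ('E_Q[contVal g] <= (supNorm g)%:E * Q U)%E.
  by rewrite QU mule0 QV lee_fin leNgt fg.
apply: expectation_le_cst => //.
- exact: borel_open.
- exact: contVal_continuous.
- by move=> x _; rewrite (le_trans (ler_norm _))// supNorm_ub.
- move=> x Ux; apply/eqP; rewrite eq_le g0 andbT leNgt.
  by apply/negP => gx; exact/Ux/gU.
Qed.

End NFLSeparating.

Theorem theorem4p18 (R : realType) (Omega : pmetricType R)
    (cO : compact [set: Omega]) (K0 : set (contSpace cO))
    (coneK0 : convex_cone K0) :
  NFL K0 <->
  exists Q : probability (borelType Omega) R,
    separating_measure Q (cone_minus_pos K0) /\ msupport Q = [set: Omega].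
Proof.
split; first exact: NFL_separating.
by move=> [Q [sepQ suppQ]]; exact: separating_NFL sepQ suppQ.
Qed.
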